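(* Let $G_1$ be an $r_1$-regular graph on $n_1$ vertices and $m_1$ edges, and $G_2$ an arbitrary graph on $n_2$ vertices. Then $$\begin{aligned}\phi\left(Q(G_1\dot{\vee} G_2);x\right)={}&(x-2)^{m_1-n_1}\cdot\Big(x^2-(2+r_1+n_2)x+2n_2-n_1(x-2)\cdot\Gamma_{Q(G_2)}(x-n_1)\Big)\\&\cdot\prod_{i=1}^{n_2}\Big(x-n_1-\nu_i(G_2)\Big)\cdot\prod_{i=1}^{n_1-1}\Big(x^2-(2+r_1+n_2)x+2(r_1+n_2)-\nu_i(G_1)\Big).\end{aligned}$$
   Context: All graphs are finite, simple and undirected, with at least one vertex. For a graph $G$ on $n$ vertices, $Q(G)=D(G)+A(G)$ is its signless Laplacian matrix ($D(G)$ the diagonal matrix of vertex degrees, $A(G)$ the adjacency matrix), with eigenvalues $\nu_1(G)\le\nu_2(G)\le\cdots\le\nu_n(G)$. For an $n\times n$ matrix $M$, $\phi(M;x)=\det(xI_n-M)$, and the $M$-coronal is the rational function $\Gamma_M(x)=\mathbf{1}_n^T(xI_n-M)^{-1}\mathbf{1}_n$ (the sum of the entries of $(xI_n-M)^{-1}$), where $\mathbf{1}_n$ is the all-ones column vector. The subdivision graph $\mathcal{S}(G)$ is obtained from $G$ by inserting a new vertex into every edge of $G$. For vertex-disjoint graphs $G_1,G_2$, the subdivision-vertex join $G_1\dot{\vee}G_2$ is the graph obtained from $\mathcal{S}(G_1)$ and $G_2$ by joining every vertex of $V(G_1)$ (the original vertices) with every vertex of $V(G_2)$. The identity is understood as an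 identity of rational functions in $x$ (the exponent $m_1-n_1$ may be negative). *)

(* Defs.v *)
From HB Require Import structures.
From mathcomp Require Import all_boot all_order all_algebra.
From mathcomp Require Import polyrcf.

Set Implicit Arguments.
Unset Strict Implicit.
Unset Printing Implicit Defensive.

Import Order.TTheory GRing.Theory Num.Theory.
Local Open Scope ring_scope.

Record sgraph := SGraph {
  vertex :> finType;
  adj : rel vertex;
  adj_sym : symmetric adj;
  adj_irr : irreflexive adj
}.

Definition degree (G : sgraph) (v : G) : nat := #|[set w | adj v w]|.

Definition regular (G : sgraph) (r : nat) : Prop := forall v : G, degree v = r.

Definition edges (G : sgraph) : {set {set G}} :=
  [set e | [exists v, exists w, adj v w && (e == [set v; w])]].

Definition edge (G : sgraph) : finType := {e : {set G} | e \in edges G}.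

Section Subdivision.
Variable G : sgraph.

Definition subdivision_adj : rel (G + edge G) := fun a b =>
  match a, b with
  | inl v, inr e | inr e, inl v => v \in val e
  | _, _ => false
  end.

Lemma subdivision_sym : symmetric subdivision_adj.
Proof. by case=> [v|e] [w|f]. Qed.

Lemma subdivision_irr : irreflexive subdivision_adj.
Proof. by case. Qed.

Definition subdivision : sgraph := SGraph subdivision_sym subdivision_irr.

End Subdivision.

Section SubdivisionVertexJoin.
Variables G1 G2 : sgraph.

Definition sv_join_adj : rel (subdivision G1 + G2) := fun a b =>
  match a, b with
  | inl s, inl t => adj s t
  | inr v, inr w => adj v w
  | inl (inl _), inr _ | inr _, inl (inl _) => true
  | inl (inr _), inr _ | inr _, inl (inr _) => false
  end.

Lemma sv_join_sym : symmetric sv_join_adj.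
Proof.
by case=> [[v|e]|v] [[w|f]|w] //=; exact: adj_sym.
Qed.

Lemma sv_join_irr : irreflexive sv_join_adj.
Proof. by case=> [[v|e]|v] /=; rewrite ?adj_irr. Qed.

Definition sv_join : sgraph := SGraph sv_join_sym sv_join_irr.

End SubdivisionVertexJoin.

Section Matrices.
Variables (R : nzRingType) (G : sgraph).

Definition adj_mx : 'M[R]_#|G| :=
  \matrix_(i, j) (adj (enum_val i) (enum_val j))%:R.

Definition degree_mx : 'M[R]_#|G| :=
  diag_mx (\row_i (degree (enum_val i))%:R).

Definition signless_laplacian : 'M[R]_#|G| := degree_mx + adj_mx.

End Matrices.

(* The eigenvalues of M lying in R, in nondecreasing order and repeated
   according to their algebraic multiplicity: rootsR lists the distinct roots
   of a nonzero polynomial in increasing order. For symmetric M, such as a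
   signless Laplacian, all n eigenvalues are in the real closed field R. *)
Definition spectrum (R : rcfType) n (M : 'M[R]_n) : seq R :=
  flatten [seq nseq (mup a (char_poly M)) a | a <- rootsR (char_poly M)].

(* Numbered from 1, as nu_1 <= ... <= nu_n. *)
Definition sl_eigenvalue (R : rcfType) (G : sgraph) (i : nat) : R :=
  (spectrum (signless_laplacian R G))`_i.-1.

Section RationalFunctions.
Variable R : fieldType.

Definition ratfun : fieldType := {fraction {poly R}}.

Definition poly_ratfun (p : {poly R}) : ratfun := tofrac p.

Definition const_ratfun (a : R) : ratfun := poly_ratfun a%:P.

Definition X_ratfun : ratfun := poly_ratfun 'X.

(* The coronal of M at the rational function t: its value at X_ratfun is the
   M-coronal itself, and its value at t is the M-coronal with t substituted for
   the variable. For nonconstant t the matrix t%:M - M is invertible, so invmx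
   is a genuine inverse. *)
Definition coronal n (M : 'M[R]_n) (t : ratfun) : ratfun :=
  ((const_mx 1 : 'rV_n) *m invmx (t%:M - map_mx const_ratfun M)
     *m (const_mx 1 : 'cV_n)) 0 0.

End RationalFunctions.

(* Main.v *)
(* Order the vertices of the join as V(G1), E(G1), V(G2). With B the
   vertex-edge incidence matrix of G1 and J an all-ones matrix, xI - Q is
     [ (x - r1 - n2) I   -B           -J              ]
     [ -B^T              (x - 2) I     0              ]
     [ -J^T               0           (x - n1) I - Q2 ].
   Eliminating the last block brings in the coronal, since J N J^T is the sum
   of the entries of N times J; eliminating the middle one brings in
   B B^T = Q1. What remains is det (t I - Q1 - c J) with
   t = (x - 2)(x - r1 - n2), a rank-one perturbation for which the all-ones row
   is a left eigenvector; the factor t - 2 r1 divided out is the one of the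
   largest eigenvalue nu_n1 = 2 r1 of Q1. *)
Require Import Defs.
From HB Require Import structures.
From mathcomp Require Import all_boot all_order all_algebra.
From mathcomp Require Import perm polyrcf complex ring.

Set Implicit Arguments.
Unset Strict Implicit.
Unset Printing Implicit Defensive.

Import Order.TTheory GRing.Theory Num.Theory.
Local Open Scope ring_scope.

(** * Spectra of real symmetric matrices and a bound on eigenvalues *)

(** [P] also intertwines the matrices $xI-A$ and $xI-B$, and its nonzero determinant cancels among
    polynomials. *)
Lemma char_poly_intertwine (F : fieldType) n (P A B : 'M[F]_n) :
  P \in unitmx -> P *m A = B *m P -> char_poly A = char_poly B.
Proof.
move=> Pu PA; pose Q := map_mx (@polyC F) P.
have Q0 : \det Q != 0.
  by rewrite det_map_mx polyC_eq0 -unitfE -unitmxE.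
have E : Q *m char_poly_mx A = char_poly_mx B *m Q.
  by rewrite /char_poly_mx mulmxBr mulmxBl -!map_mxM PA scalar_mxC.
apply: (mulfI Q0).
by rewrite /char_poly -det_mulmx E det_mulmx mulrC.
Qed.

Section Spectrum.
Variables (R : rcfType) (n : nat).
Implicit Type A : 'M[R]_n.

(** The complexification is Hermitian, hence unitarily diagonalisable with real diagonal;
    injectivity of [map_poly] brings the factorisation back to [R]. *)
Lemma char_poly_symmetric_split A : A^T = A ->
  exists s : seq R, char_poly A = \prod_(a <- s) ('X - a%:P).
Proof.
move=> symA; pose toC := real_complex R; pose B := map_mx toC A.
have hB : B \is hermsymmx.
  apply: realsym_hermsym.
    apply/is_hermitianmxP; apply/matrixP => i j.
    by rewrite expr0 scale1r !mxE /= -[in LHS]symA mxE.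
  by apply/mxOverP => i j; rewrite mxE complex_real.
have /orthomx_spectralP E := hermitian_normalmx hB.
have spR := hermitian_spectral_diag_real hB.
set P := spectralmx B in E; set d := spectral_diag B in E spR.
have Pu : P \in unitmx by exact: spectral_unit.
exists [seq complex.Re (d 0 i) | i : 'I_n].
apply: (map_poly_inj toC); rewrite map_char_poly -/B.
rewrite (@char_poly_intertwine _ _ P _ (diag_mx d)) //; last first.
  by rewrite E -!mulmxA mulKVmx.
rewrite char_poly_trig ?diag_mx_is_trig // big_map big_enum /= rmorph_prod.
apply: eq_bigr => i _; rewrite rmorphB /= map_polyX map_polyC /=.
rewrite mxE eqxx mulr1n.
by congr ('X - _%:P); apply/esym/RRe_real/mxOverP.
Qed.

Lemma spectrum_sorted A : sorted <=%R (spectrum A).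
Proof.
(* Unlike [sorted], the pairwise form splits over the concatenation of constant blocks. *)
rewrite sorted_pairwise; last exact: le_trans.
rewrite /spectrum.
have: sorted <%R (rootsR (char_poly A)) by exact: sorted_roots.
rewrite sorted_pairwise; last exact: lt_trans.
elim: (rootsR _) => //= a s IHs /andP[ltas /IHs srt].
rewrite pairwise_cat srt andbT; apply/andP; split.
  apply/allrelP => x y; rewrite mem_nseq => /andP[_ /eqP->].
  case/flatten_mapP => b bs; rewrite mem_nseq => /andP[_ /eqP->].
  exact/ltW/(allP ltas).
elim: (mup a _) => //= k ->; rewrite andbT.
by apply/allP => y; rewrite mem_nseq => /andP[_ /eqP->].
Qed.

Lemma char_poly_spectrum A : A^T = A ->
  char_poly A = \prod_(a <- spectrum A) ('X - a%:P).
Proof.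
move=> /char_poly_symmetric_split[s Ds]; rewrite {1}Ds.
have A0 : char_poly A != 0 by rewrite monic_neq0 ?char_poly_monic.
apply: perm_big; rewrite perm_sym.
(* Up to order, [s] is its distinct members, each repeated as often as it occurs; that count is the
   multiplicity as a root. *)
apply: perm_trans (perm_count_undup s).
rewrite -(eq_map (f := fun a => nseq (mup a (char_poly A)) a)); last first.
  by move=> a; rewrite Ds mu_prod_XsubC.
apply: perm_flatten; apply: perm_map; apply: uniq_perm.
- exact: uniq_roots.
- exact: undup_uniq.
- move=> a; rewrite mem_undup -[RHS]root_prod_XsubC -Ds.
  by rewrite -(roots_on_rootsR A0) in_itv.
Qed.

Lemma size_spectrum A : A^T = A -> size (spectrum A) = n.
Proof.
move=> /char_poly_spectrum E; have := size_char_poly A.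
by rewrite {1}E size_prod_XsubC => -[].
Qed.

Lemma mem_spectrum A a : A^T = A -> (a \in spectrum A) = eigenvalue A a.
Proof.
by move=> /char_poly_spectrum E; rewrite eigenvalue_root_char E root_prod_XsubC.
Qed.

Lemma last_spectrum A c : A^T = A -> eigenvalue A c ->
  (forall a, eigenvalue A a -> a <= c) -> (spectrum A)`_n.-1 = c.
Proof.
move=> symA; rewrite -mem_spectrum // => c_s c_max.
have sz := size_spectrum symA.
have n0 : (0 < n)%N by rewrite -sz; case: spectrum c_s.
apply/le_anti/andP; split.
  by apply: c_max; rewrite -mem_spectrum // mem_nth // sz prednK.
rewrite -{1}(nth_index 0 c_s).
apply: (sorted_leq_nth le_trans le_refl 0 (spectrum_sorted A)).
- by rewrite inE index_mem.
- by rewrite inE sz prednK.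
- by rewrite -ltnS prednK // -[X in (_ < X)%N]sz index_mem.
Qed.
End Spectrum.

(** For a left eigenvector $v$ and $j$ maximising $|v_j|$, $a|v_j| \le \sum_i |v_i| A_{ij} \le
    c|v_j|$. Column sums appear because eigenvectors are rows here. *)
Lemma eigenvalue_le_colsum (R : realFieldType) n (A : 'M[R]_n) (c a : R) :
  (forall i j, 0 <= A i j) -> (forall j, \sum_i A i j = c) ->
  eigenvalue A a -> a <= c.
Proof.
move=> A_ge0 A_sum /eigenvalueP[v vA /rV0Pn[i0 vi0]].
have [j _ jmax] :=
  @Order.TotalTheory.arg_maxP _ _ _ i0 predT (fun i => `|v 0 i|) isT.
have vj0 : 0 < `|v 0 j| by apply: lt_le_trans (jmax i0 isT); rewrite normr_gt0.
rewrite -(ler_pM2r vj0).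
have /(congr1 (fun w : 'rV_n => w 0 j)) := vA; rewrite !mxE => E.
apply: le_trans (_ : `|a * v 0 j| <= _).
  by rewrite normrM ler_wpM2r ?ler_norm.
rewrite -E -(A_sum j) mulr_suml (le_trans (ler_norm_sum _ _ _)) //.
rewrite ler_sum // => i _.
by rewrite normrM (ger0_norm (A_ge0 _ _)) mulrC ler_wpM2l //; apply: jmax.
Qed.

(** * Determinant identities: Schur complements, rank-one perturbations, reindexing *)

Section Determinants.
Variable F : fieldType.

Lemma det_schur m n (A : 'M[F]_m) B C (D : 'M_n) : D \in unitmx ->
  \det (block_mx A B C D) = \det D * \det (A - B *m invmx D *m C).
Proof.
move=> Du.
have -> : block_mx A B C D =
    block_mx (A - B *m invmx D *m C) B 0 D
      *m block_mx 1%:M 0 (invmx D *m C) 1%:M.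
  rewrite mulmx_block !mulmx0 !mul0mx !mulmx1 !add0r mulKVmx //.
  by rewrite mulmxA subrK.
by rewrite det_mulmx det_ublock det_lblock !det1 !mulr1 mulrC.
Qed.

(** The block matrix with rows $(I, u)$ and $(v, 1)$ is factored in two ways, and the determinants
    are compared. *)
Lemma det1B_rank1 n (u : 'cV[F]_n) (v : 'rV_n) :
  \det (1%:M - u *m v) = 1 - (v *m u) 0 0.
Proof.
have E : block_mx (1%:M - u *m v) u 0 1%:M *m block_mx 1%:M 0 v 1%:M =
         block_mx 1%:M 0 v 1%:M *m block_mx 1%:M u 0 (1%:M - v *m u).
  rewrite !mulmx_block !mulmx0 !mul0mx !mulmx1 !mul1mx !add0r !addr0.
  by rewrite subrK addrC subrK.
have /(congr1 determinant) := E.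
rewrite !det_mulmx !det_ublock !det_lblock !det1 !mulr1 !mul1r => ->.
by rewrite det_mx11 !mxE eqxx.
Qed.

Lemma const_mx_rank1 (m n : nat) :
  (const_mx 1 : 'M[F]_(m, n)) = (const_mx 1 : 'cV_m) *m (const_mx 1 : 'rV_n).
Proof. by apply/matrixP => i j; rewrite !mxE big_ord1 !mxE mulr1. Qed.

(** Every entry of the left side is the sum of all entries of [N]; this is how the coronal
    arises. *)
Lemma const_mx_sandwich m n p (N : 'M[F]_n) :
  (const_mx 1 : 'M_(m, n)) *m N *m (const_mx 1 : 'M_(n, p)) =
  ((const_mx 1 : 'rV_n) *m N *m (const_mx 1 : 'cV_n)) 0 0 *: const_mx 1.
Proof.
apply/matrixP => i j; rewrite !mxE mulr1; apply: eq_bigr => k _.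
by rewrite !mxE; congr (_ * _); apply: eq_bigr => l _; rewrite !mxE.
Qed.

(** With $J$ the all-ones matrix, the hypothesis gives $JB = sJ$, so $B - cJ = (I - (c/s)J)B$, whose
    first factor is a rank-one perturbation of $I$. *)
Lemma det_sub_const n (B : 'M[F]_n) (s c : F) : s != 0 ->
  (const_mx 1 : 'rV_n) *m B = s *: const_mx 1 ->
  s * \det (B - c *: const_mx 1) = (s - n%:R * c) * \det B.
Proof.
move=> s0 oneB.
have -> : B - c *: const_mx 1 =
    (1%:M - (c / s) *: (const_mx 1 : 'cV_n) *m (const_mx 1 : 'rV_n)) *m B.
  rewrite mulmxBl mul1mx -mulmxA oneB -scalemxAr -!scalemxAl scalerA.
  by rewrite mulrC divfK // -const_mx_rank1.
rewrite det_mulmx det1B_rank1 mulrA; congr (_ * _).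
rewrite !mxE mulrBr mulr1; congr (_ - _).
under eq_bigr do rewrite !mxE mulr1 mul1r.
by rewrite sumr_const card_ord mulrnAr mulrC divfK // mulr_natl.
Qed.

(** Two enumerations of [T] differ by a permutation acting on both rows and columns, so its sign
    occurs twice and cancels. *)
Lemma det_reindex (T : finType) n (h : 'I_n -> T) (f : T -> T -> F) :
  bijective h ->
  \det (\matrix_(i < #|T|, j < #|T|) f (enum_val i) (enum_val j)) =
  \det (\matrix_(i < n, j < n) f (h i) (h j)).
Proof.
move=> h_bij; have := bij_eq_card h_bij; rewrite card_ord => En; subst n.
have h_inj : injective (enum_rank \o h).
  by apply: inj_comp; [exact: enum_rank_inj | exact: bij_inj].
set M := \matrix_(i, j) f (enum_val i) _.
pose s := perm h_inj.
have -> : \matrix_(i, j) f (h i) (h j) = row_perm s (col_perm s M).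
  by apply/matrixP => i j; rewrite !mxE !permE /= !enum_rankK.
rewrite row_permE col_permE !det_mulmx !det_perm odd_permV.
by rewrite mulrCA -signr_addb addbb mulr1.
Qed.

End Determinants.

(** * Enumerating a disjoint union blockwise *)

Section OrdSum.
Variables (A B : finType) (m n : nat) (f : 'I_m -> A) (g : 'I_n -> B).

(** All of [A] is listed before [B], so that indices split as those of a block matrix do. *)
Definition ord_sum (k : 'I_(m + n)) : A + B :=
  match split k with inl i => inl (f i) | inr j => inr (g j) end.

Lemma ord_suml i : ord_sum (lshift n i) = inl (f i).
Proof. by rewrite /ord_sum (unsplitK (inl i)). Qed.

Lemma ord_sumr j : ord_sum (rshift m j) = inr (g j).
Proof. by rewrite /ord_sum (unsplitK (inr j)). Qed.

Lemma ord_sum_bij : bijective f -> bijective g -> bijective ord_sum.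
Proof.
move=> [f' fK f'K] [g' gK g'K].
exists (fun x => match x with
  inl a => lshift n (f' a) | inr b => rshift m (g' b) end) => [k|[a|b]].
- by case: (split_ordP k) => i ->; rewrite ?ord_suml ?ord_sumr ?fK ?gK.
- by rewrite ord_suml f'K.
- by rewrite ord_sumr g'K.
Qed.

End OrdSum.

(** * Counting edges through one or two vertices *)

Section Graph.
Variable G : sgraph.

Lemma degreeE (v : G) : degree v = (\sum_w adj v w)%N.
Proof.
rewrite /degree cardsE -sum1_card big_mkcond; apply: eq_bigr => w _.
by rewrite unfold_in.
Qed.

Lemma edgesP (e : {set G}) :
  reflect (exists v w : G, adj v w /\ e = [set v; w]) (e \in edges G).
Proof.
rewrite inE; apply: (iffP existsP) => [[v /existsP[w /andP[vw /eqP->]]]|].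
  by exists v, w.
move=> [v [w [vw ->]]]; exists v; apply/existsP; exists w.
by rewrite vw eqxx.
Qed.

Lemma adj_neq (v w : G) : adj v w -> v != w.
Proof. by apply: contraTneq => ->; rewrite adj_irr. Qed.

Lemma card_edge (e : edge G) : #|val e| = 2.
Proof.
have /edgesP[v [w [vw ->]]] := valP e.
by rewrite cards2 adj_neq.
Qed.

Lemma edge_with_endpoint (v : G) (e : {set G}) :
  (e \in edges G) && (v \in e) =
  (e \in [set [set v; w] | w in [set w | adj v w]]).
Proof.
apply/andP/imsetP => [[/edgesP[u [w [uw ->]]]]|[w]].
  rewrite !inE => /orP[]/eqP->; first by exists w; rewrite ?inE.
  by exists u; rewrite ?inE 1?adj_sym // setUC.
rewrite inE => vw ->; rewrite !inE eqxx; split=> //.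
by apply/existsP; exists v; apply/existsP; exists w; rewrite vw eqxx.
Qed.

(** The neighbours $w$ of $v$ correspond to the edges at $v$ through $w \mapsto \{v,w\}$. This
    yields the diagonal of $BB^T$. *)
Lemma sum_edge_mem (v : G) : (\sum_(e : edge G) (v \in val e) = degree v)%N.
Proof.
rewrite -(big_sub _ (fun e : {set G} => nat_of_bool (v \in e))) -big_mkcondr /=.
under eq_bigl => e do rewrite edge_with_endpoint.
rewrite sum1_card card_in_imset // => w1 w2.
rewrite !inE => /adj_neq vw1 /adj_neq vw2 /setP/(_ w1).
by rewrite !inE eqxx orbT eq_sym (negbTE vw1) /= => /esym/eqP.
Qed.

(** The only edge that can contain both vertices is $\{v,w\}$. This yields the off-diagonal entries
    of $BB^T$. *)
Lemma sum_edge_mem2 (v w : G) : v != w ->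
  (\sum_(e : edge G) (v \in val e) * (w \in val e) = adj v w)%N.
Proof.
move=> vw; under eq_bigr => e _ do rewrite mulnb.
rewrite -(big_sub _ (fun e : {set G} => nat_of_bool ((v \in e) && (w \in e)))).
rewrite -big_mkcondr /=.
have E e : (e \in edges G) && ((v \in e) && (w \in e)) =
    (e \in [set e | adj v w & e == [set v; w]]).
  rewrite andbA edge_with_endpoint inE; apply/andP/andP.
    move=> [/imsetP[u]]; rewrite inE => vu ->.
    by rewrite !inE eq_sym (negbTE vw) /= => /eqP->; rewrite vu eqxx.
  move=> [avw /eqP->]; rewrite !inE eqxx orbT; split=> //.
  by apply/imsetP; exists w; rewrite ?inE.
under eq_bigl => e do rewrite E.
rewrite sum1_card; case: (adj v w) => /=; last first.
  by apply: eq_card0 => e; rewrite !inE.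
by rewrite -[RHS](cards1 [set v; w]); apply: eq_card => e; rewrite !inE.
Qed.

End Graph.

(** * The signless Laplacian and its eigenvalues *)

Section SignlessLaplacian.
Variable R : nzRingType.
Implicit Type G : sgraph.

(** Indexed by vertices rather than ordinals, so that the vertices can be enumerated in another
    order. *)
Definition sl_entry G (u v : G) : R := (degree u)%:R *+ (u == v) + (adj u v)%:R.

Lemma signless_laplacianE G i j :
  signless_laplacian R G i j = sl_entry (enum_val i) (enum_val j).
Proof. by rewrite !mxE /sl_entry (inj_eq enum_val_inj). Qed.

Lemma sl_entryC G (u v : G) : sl_entry u v = sl_entry v u.
Proof. by rewrite /sl_entry adj_sym eq_sym; case: eqP => [->|]. Qed.

Lemma trmx_signless_laplacian G :
  (signless_laplacian R G)^T = signless_laplacian R G.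
Proof. by apply/matrixP => i j; rewrite mxE !signless_laplacianE sl_entryC. Qed.

(** The diagonal entry and the adjacency column contribute the degree once each. *)
Lemma signless_laplacian_colsum G j :
  \sum_i signless_laplacian R G i j = (2 * degree (enum_val j))%:R.
Proof.
under eq_bigr => i _ do rewrite signless_laplacianE sl_entryC.
rewrite -(big_enum_val (A := G) (sl_entry (enum_val j))) /=.
rewrite big_split /= -natr_sum -degreeE mul2n -addnn natrD; congr (_ + _).
rewrite (bigD1 (enum_val j)) //= eqxx mulr1n big1 ?addr0 // => v.
by rewrite eq_sym => /negbTE->.
Qed.

Lemma signless_laplacian_regular G r : regular G r ->
  (const_mx 1 : 'rV_#|G|) *m signless_laplacian R G = (2 * r)%:R *: const_mx 1.
Proof.
move=> Gr; apply/rowP => j; rewrite !mxE mulr1 -(Gr (enum_val j)).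
rewrite -signless_laplacian_colsum; apply: eq_bigr => i _.
by rewrite mxE mul1r.
Qed.

End SignlessLaplacian.

Lemma map_signless_laplacian (R S : nzRingType) (f : {rmorphism R -> S}) G :
  map_mx f (signless_laplacian R G) = signless_laplacian S G.
Proof.
apply/matrixP => i j; rewrite mxE !signless_laplacianE.
by rewrite rmorphD rmorphMn !rmorph_nat.
Qed.

(** The all-ones row is an eigenvector for $2r$, and the column sums, all equal to $2r$, bound every
    eigenvalue. *)
Lemma sl_eigenvalue_last (R : rcfType) (G : sgraph) r :
  (0 < #|G|)%N -> regular G r -> sl_eigenvalue R G #|G| = (2 * r)%:R.
Proof.
move=> G0 Gr; apply: last_spectrum; first exact: trmx_signless_laplacian.
  apply/eigenvalueP; exists (const_mx 1).
    exact: signless_laplacian_regular.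
  by apply/rV0Pn; exists (Ordinal G0); rewrite mxE oner_eq0.
move=> a; apply: eigenvalue_le_colsum => [i j|j].
  by rewrite signless_laplacianE addr_ge0 ?mulrn_wge0 ?ler0n.
by rewrite signless_laplacian_colsum Gr.
Qed.

(** The characteristic polynomial splits over [R]; the splitting is transported along [f] and
    evaluated at [t], which will be a rational function. *)
Lemma det_signless_laplacian (R : rcfType) (K : fieldType)
    (f : {rmorphism R -> K}) (G : sgraph) (t : K) :
  \det (t%:M - signless_laplacian K G) =
  \prod_(1 <= i < #|G|.+1) (t - f (sl_eigenvalue R G i)).
Proof.
have symQ := trmx_signless_laplacian R G.
have -> : \det (t%:M - signless_laplacian K G) =
          (char_poly (signless_laplacian K G)).[t].
  rewrite -horner_evalE -det_map_mx; congr (\det _); apply/matrixP => i j.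
  by rewrite !mxE /= horner_evalE hornerD hornerN hornerMn hornerX !hornerC.
rewrite -(map_signless_laplacian f) -map_char_poly (char_poly_spectrum symQ).
(* The shift by [big_add1] matches the numbering of eigenvalues from 1 with list positions from
   0. *)
rewrite rmorph_prod horner_prod (big_nth 0) size_spectrum // big_add1 /=.
by apply: eq_bigr => i _; rewrite rmorphB /= map_polyX map_polyC /= hornerXsubC.
Qed.

(** * The determinant of the join by block elimination *)

Section JoinDeterminant.
Variables (K : fieldType) (G1 G2 : sgraph).
Implicit Types x : K.

Local Notation H := (sv_join G1 G2).
Local Notation n1 := #|G1|.
Local Notation n2 := #|G2|.

Definition incidence_mx : 'M[K]_(#|G1|, #|edge G1|) :=
  \matrix_(i, e) (enum_val i \in val (enum_val e : edge G1))%:R.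

Lemma incidence_mx_mul_tr :
  incidence_mx *m incidence_mx^T = signless_laplacian K G1.
Proof.
apply/matrixP => i j; rewrite signless_laplacianE mxE.
set v := enum_val i; set w := enum_val j.
transitivity ((\sum_(e : edge G1) (v \in val e) * (w \in val e))%N%:R : K).
  rewrite natr_sum (reindex (@enum_val (edge G1) (edge G1))) /=; last first.
    by apply: onW_bij; apply: enum_val_bij.
  by apply: eq_bigr => e _; rewrite !mxE natrM.
rewrite /sl_entry; have [->|vw] := eqVneq v w.
  rewrite adj_irr addr0 mulr1n -sum_edge_mem; congr _%:R.
  by apply: eq_bigr => e _; rewrite mulnb andbb.
by rewrite sum_edge_mem2 // add0r.
Qed.

Lemma degree_join_vertex (v : G1) :
  degree (inl (inl v) : H) = (degree v + n2)%N.
Proof.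
rewrite degreeE !big_sumType /= big1 // add0n sum_edge_mem; congr (_ + _)%N.
by rewrite sum1_card.
Qed.

Lemma degree_join_edge (e : edge G1) : degree (inl (inr e) : H) = 2.
Proof.
rewrite degreeE !big_sumType /=.
rewrite [X in (_ + X + _)%N]big1 // [X in (_ + X)%N]big1 // !addn0.
by rewrite -(card_edge e) -sum1_card [RHS]big_mkcond.
Qed.

Lemma degree_join_right (v : G2) : degree (inr v : H) = (degree v + n1)%N.
Proof.
rewrite degreeE !big_sumType /= sum1_card big1 // addn0 addnC -degreeE.
by [].
Qed.

Lemma det_join_blocks r x : regular G1 r ->
  \det (x%:M - signless_laplacian K H) =
  \det (block_mx
    (block_mx (x - (r + n2)%:R)%:M (- incidence_mx)
              (- incidence_mx^T) (x - 2%:R)%:M)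
    (col_mx (- const_mx 1) 0) (row_mx (- const_mx 1) 0)
    ((x - n1%:R)%:M - signless_laplacian K G2)).
Proof.
move=> G1r.
pose h := ord_sum (ord_sum (@enum_val G1 G1) (@enum_val (edge G1) (edge G1)))
  (@enum_val G2 G2).
have h_bij : bijective h by do 2?apply: ord_sum_bij; apply: enum_val_bij.
(* The default enumeration of the join is replaced by the blockwise enumeration [h]. *)
transitivity (\det (\matrix_(i, j)
    (x *+ (h i == h j) - @sl_entry K H (h i) (h j)))).
  rewrite -(det_reindex (fun u v : H => x *+ (u == v) - sl_entry K u v) h_bij).
  congr (\det _); apply/matrixP => i j.
  by rewrite !mxE -signless_laplacianE (inj_eq enum_val_inj) !mxE.
congr (\det _); apply/matrixP => i j; rewrite mxE /sl_entry.
case: (split_ordP i) => {}i ->; [case: (split_ordP i) => {}i ->|];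
  case: (split_ordP j) => {}j ->;
  [case: (split_ordP j) => {}j ->| | case: (split_ordP j) => {}j ->| |
   case: (split_ordP j) => {}j ->|];
rewrite /h ?ord_suml ?ord_sumr
  ?degree_join_vertex ?degree_join_edge ?degree_join_right
  ?block_mxEul ?block_mxEur ?block_mxEdl ?block_mxEdr ?col_mxEu ?col_mxEd
  ?row_mxEl ?row_mxEr ?mxE /=.
all: rewrite ?mulr0n ?add0r ?addr0 ?oppr0 ?sub0r //.
(* Only the three diagonal blocks remain, where the degrees in the join enter. *)
- rewrite -[inl _ == _]/(enum_val i == enum_val j) (inj_eq enum_val_inj) G1r.
  by rewrite mulrnBl.
- rewrite -[inl _ == _]/(enum_val i == enum_val j) (inj_eq enum_val_inj).
  by rewrite mulrnBl.
- rewrite -[inr _ == _]/(enum_val i == enum_val j) (inj_eq enum_val_inj).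
  by rewrite natrD; case: (i == j); rewrite ?mulr1n ?mulr0n; ring.
Qed.

(** The powers of [b] and the factor $t - 2r$ are kept multiplied out to avoid quotients. The three
    nonvanishing conditions serve the two eliminations and the rank-one step. *)
Lemma det_signless_laplacian_join r x :
  regular G1 r ->
  let b := x - 2%:R in
  let t := (x - (r + n2)%:R) * b in
  let M := (x - n1%:R)%:M - signless_laplacian K G2 in
  let gamma :=
    ((const_mx 1 : 'rV_n2) *m invmx M *m (const_mx 1 : 'cV_n2)) 0 0 in
  b != 0 -> t != (2 * r)%:R -> \det M != 0 ->
  \det (x%:M - signless_laplacian K H) * b ^+ n1 * (t - (2 * r)%:R) =
  b ^+ #|edges G1| * (t - (2 * r)%:R - n1%:R * b * gamma) * \det M
  * \det (t%:M - signless_laplacian K G1).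
Proof.
move=> G1r b t M gamma b0 t0 M0.
have Mu : M \in unitmx by rewrite unitmxE unitfE.
have bu : b%:M \in @unitmx K #|edge G1|.
  by rewrite unitmxE det_scalar unitfE expf_neq0.
rewrite (det_join_blocks _ G1r) -/b -/M det_schur //.
have -> : col_mx (- const_mx 1) 0 *m invmx M *m row_mx (- const_mx 1) 0 =
    block_mx (gamma *: const_mx 1) 0 0 0 :> 'M_(#|G1| + #|edge G1|).
  rewrite mul_col_mx mul0mx mul_col_row !mul0mx !mulmx0; congr block_mx.
  rewrite mulNmx mulmxN mulNmx opprK; exact: const_mx_sandwich.
rewrite opp_block_mx add_block_mx !oppr0 !addr0 det_schur // det_scalar.
rewrite invmx_scalar mul_mx_scalar -scalemxAl.
rewrite mulNmx mulmxN opprK incidence_mx_mul_tr.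
have -> : #|edge G1| = #|edges G1|.
  by rewrite card_sig; apply: eq_card => e; rewrite inE.
set Q := signless_laplacian K G1; set A := (_ - _ - _).
(* Scaling by [b] clears the inverse of the middle block, at the price of $b^{n_1}$ in the
   determinant. *)
have EA : b *: A = (t%:M - Q) - (b * gamma) *: const_mx 1.
  rewrite /A !scalerBr !scalerA mulfV // scale1r scale_scalar_mx.
  by rewrite /t [in RHS]mulrC addrAC.
have E : \det A * b ^+ n1 = \det (b *: A) by rewrite detZ mulrC.
have := @det_sub_const _ _ (t%:M - Q) (t - (2 * r)%:R) (b * gamma).
rewrite -EA subr_eq0 => /(_ t0) D.
have {D} : (t - (2 * r)%:R) * \det (b *: A) =
    (t - (2 * r)%:R - n1%:R * (b * gamma)) * \det (t%:M - Q).
  apply: D; rewrite mulmxBr mul_mx_scalar (signless_laplacian_regular K G1r).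
  by rewrite scalerBl.
rewrite -E => D.
move: (\det A) (\det M) (\det (t%:M - Q)) D => dA dM dB D.
rewrite -!mulrA [dA * _]mulrA [_ * (t - _)]mulrC D.
by rewrite mulrCA [dM * (_ * dB)]mulrCA.
Qed.

End JoinDeterminant.

(** * The identity between rational functions *)

Theorem theorem2p12 (R : rcfType) (G1 G2 : sgraph) (r1 n1 m1 n2 : nat)
    (n1_gt0 : (0 < n1)%N) (n2_gt0 : (0 < n2)%N)
    (G1_regular : regular G1 r1)
    (G1_order : #|G1| = n1) (G1_size : #|edges G1| = m1)
    (G2_order : #|G2| = n2) :
  let x := X_ratfun R in
  poly_ratfun (char_poly (signless_laplacian R (sv_join G1 G2))) =
    (x - 2%:R) ^ (m1%:Z - n1%:Z)
    * (x ^+ 2 - (2 + r1 + n2)%:R * x + (2 * n2)%:R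
       - n1%:R * (x - 2%:R)
         * coronal (signless_laplacian R G2) (x - n1%:R))
    * (\prod_(1 <= i < n2.+1)
         (x - n1%:R - const_ratfun (sl_eigenvalue R G2 i)))
    * (\prod_(1 <= i < n1)
         (x ^+ 2 - (2 + r1 + n2)%:R * x + (2 * (r1 + n2))%:R
          - const_ratfun (sl_eigenvalue R G1 i))).
Proof.
move=> x; subst n1 m1 n2.
pose f : {rmorphism R -> ratfun R} := @tofrac {poly R} \o polyC.
set b := x - 2%:R; set t := (x - (r1 + #|G2|)%:R) * b.
have b0 : b != 0.
  rewrite /b -[2%:R](rmorph_nat (@tofrac {poly R})) -rmorphB tofrac_eq0.
  by rewrite -polyC_natr polyXsubC_eq0.
have Dt : t - (2 * r1)%:R = x ^+ 2 - (2 + r1 + #|G2|)%:R * x + (2 * #|G2|)%:R.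
  by rewrite /t /b !natrM !natrD; ring.
have t0 : t != (2 * r1)%:R.
  rewrite /t /b /x /X_ratfun /poly_ratfun -!(rmorph_nat (@tofrac {poly R})).
  rewrite -!rmorphB -rmorphM tofrac_eq.
  (* At this point the two factors of $t$ are $2$ and $r_1+n_2$; the value $2(r_1+n_2)$ differs from
     $2r_1$ because $n_2 > 0$. *)
  apply/eqP => /(congr1 (fun p => p.[(r1 + #|G2| + 2)%:R])).
  rewrite -!polyC_natr !(hornerM, hornerD, hornerN, hornerX, hornerC).
  have -> : ((r1 + #|G2| + 2)%:R - (r1 + #|G2|)%:R)
      * ((r1 + #|G2| + 2)%:R - 2%:R) = (2 * (r1 + #|G2|))%:R :> R.
    by rewrite !natrM !natrD; ring.
  move/eqP; rewrite eqr_nat eqn_pmul2l // -[X in _ == X]addn0.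
  by rewrite eqn_add2l gtn_eqF.
have DM : \det ((x - #|G1|%:R)%:M - signless_laplacian (ratfun R) G2) =
    \prod_(1 <= i < #|G2|.+1)
      (x - #|G1|%:R - const_ratfun (sl_eigenvalue R G2 i)).
  exact: (det_signless_laplacian f).
have DQ : \det (t%:M - signless_laplacian (ratfun R) G1) =
    (t - (2 * r1)%:R)
    * \prod_(1 <= i < #|G1|) (x ^+ 2 - (2 + r1 + #|G2|)%:R * x
        + (2 * (r1 + #|G2|))%:R - const_ratfun (sl_eigenvalue R G1 i)).
  (* The last factor, for $\nu_{n_1} = 2r_1$, is split off; it exists since $n_1 > 0$. *)
  rewrite (det_signless_laplacian f) big_nat_recr //= mulrC.
  rewrite (sl_eigenvalue_last R n1_gt0 G1_regular) !rmorph_nat; congr (_ * _).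
  apply: eq_bigr => i _; congr (_ - _).
  by rewrite /t /b !natrM !natrD; ring.
have M0 : \det ((x - #|G1|%:R)%:M - signless_laplacian (ratfun R) G2) != 0.
  rewrite DM prodf_seq_neq0; apply/allP => i _ /=.
  (* Each factor is a monic linear polynomial in $x$, hence nonzero. *)
  rewrite -(rmorph_nat (@tofrac {poly R})) -!rmorphB tofrac_eq0.
  by rewrite -addrA -opprD -polyC_natr -polyCD polyXsubC_eq0.
have := det_signless_laplacian_join G1_regular b0 t0 M0.
rewrite DM DQ -/t => E.
have -> : poly_ratfun (char_poly (signless_laplacian R (sv_join G1 G2))) =
    \det (x%:M - signless_laplacian (ratfun R) (sv_join G1 G2)).
  (* The determinant commutes with the embedding of polynomials into their fraction field. *)
  rewrite /char_poly -[LHS]/(tofrac _) -det_map_mx.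
  rewrite /char_poly_mx map_mxB map_scalar_mx.
  by rewrite -map_mx_comp (map_signless_laplacian f).
have -> : coronal (signless_laplacian R G2) (x - #|G1|%:R) =
  ((const_mx 1 : 'rV_#|G2|)
    *m invmx ((x - #|G1|%:R)%:M - signless_laplacian (ratfun R) G2)
    *m (const_mx 1 : 'cV_#|G2|)) 0 0.
  by rewrite /coronal (map_signless_laplacian f).
rewrite -Dt expfzDr // -exprnP -exprnN.
(* Multiplying by $b^{n_1}$ and $t - 2r_1$, both nonzero, reduces the claim to [E]. *)
apply: (mulIf (expf_neq0 #|G1| b0)).
apply: (mulIf (_ : t - (2 * r1)%:R != 0)).
  by rewrite subr_eq0.
rewrite E -!mulrA; congr (_ * _).
set A := (X in X * _ = _); set B := \prod_(_ <= _ < _) _.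
set C := \prod_(_ <= _ < _) _.
rewrite [C * _]mulrCA [B * _ in RHS]mulrCA [A * _ in RHS]mulrCA.
by rewrite (mulKf (expf_neq0 _ b0)) [C * _]mulrC.
Qed.
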